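(* Let $(M,\varphi,\xi,\eta,g)$ be a $3$-dimensional trans-Sasakian manifold of type $(\alpha,\beta)$ equipped with a Newman--Penrose frame $(\partial,\overline{\partial},\xi)$. Then the Riemann--Christoffel curvature tensor $R$ of $M$ is given by $$R(\partial,\overline{\partial},\overline{\partial},\partial)=|\rho_{\mathrm{np}}|^2+2|\beta_{\mathrm{np}}|^2+(\rho_{\mathrm{np}}-\overline{\rho_{\mathrm{np}}})\epsilon_{\mathrm{np}}+\partial(\overline{\beta_{\mathrm{np}}})+\overline{\partial}(\beta_{\mathrm{np}}),$$ $$R(\partial,\overline{\partial},\xi,\partial)=\partial(\rho_{\mathrm{np}}),$$ $$R(\partial,\xi,\xi,\partial)=0,$$ $$R(\partial,\xi,\xi,\overline{\partial})=-\xi(\rho_{\mathrm{np}})-\rho_{\mathrm{np}}^2.$$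
   Context: An almost contact metric structure $(\varphi,\xi,\eta,g)$ on $M$: $\varphi$ a $(1,1)$-tensor, $\xi$ a vector field, $\eta$ a $1$-form, $g$ a Riemannian metric with $\varphi^2=-I+\eta\otimes\xi$, $\eta(\xi)=1$, $\varphi\xi=0$, $\eta\circ\varphi=0$, $g(\varphi X,\varphi Y)=g(X,Y)-\eta(X)\eta(Y)$. It is trans-Sasakian of type $(\alpha,\beta)$ ($\alpha,\beta$ smooth functions) if $(\nabla_X\varphi)Y=\alpha(g(X,Y)\xi-\eta(Y)X)+\beta(g(\varphi X,Y)\xi-\eta(Y)\varphi X)$, with $\nabla$ the Levi-Civita connection. Newman--Penrose frame: for an orthonormal frame $(e_1,e_2,\xi)$, put $\partial=\frac1{\sqrt2}(e_1-ie_2)$, $\overline{\partial}=\frac1{\sqrt2}(e_1+ie_2)$, chosen so that $\varphi\partial=i\partial$, $\varphi\overline{\partial}=-i\overline{\partial}$ (i.e. $\varphi e_1=e_2$). All tensors and $\nabla$ are extended complex-(multi)linearly, so $g(\xi,\xi)=g(\partial,\overline{\partial})=1$ and $g(\xi,\partial)=g(\partial,\partial)=g(\overline{\partial},\overline{\partial})=0$. Spin coefficients: $\sigma_{\mathrm{np}}=-g(\partial,\nabla_\partial\xi)$, $\rho_{\mathrm{np}}=g(\partial,\nabla_{\overline{\partial}}\xi)$, $\kappa_{\mathrm{np}}=-g(\partial,\nabla_\xi\xi)$, $\beta_{\mathrm{np}}=g(\overline{\partial},\nabla_\partial\partial)$, $\epsilon_{\mathrm{np}}=g(\overline{\partial},\nabla_\xi\partial)$.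 In these terms the trans-Sasakian condition of type $(\alpha,\beta)$ reads $\kappa_{\mathrm{np}}=\sigma_{\mathrm{np}}=0$, $\rho_{\mathrm{np}}=\beta+i\alpha$. For a function $f$, $\partial(f),\overline{\partial}(f),\xi(f)$ denote derivatives along these vector fields. Curvature convention: $R(X,Y)Z=\nabla_X\nabla_YZ-\nabla_Y\nabla_XZ-\nabla_{[X,Y]}Z$ and $R(X,Y,Z,W)=g(R(X,Y)Z,W)$ (so $R(X,Y,Y,X)>0$ on round spheres for linearly independent real $X,Y$). *)

(* Defs.v *)
From HB Require Import structures.
From mathcomp Require Import all_boot all_order all_algebra complex ring.
From mathcomp Require Import all_classical all_reals all_analysis.

Set Implicit Arguments.
Unset Strict Implicit.
Unset Printing Implicit Defensive.
Import Order.TTheory GRing.Theory Num.Theory.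
Import numFieldNormedType.Exports.
Local Open Scope classical_set_scope.
Local Open Scope ring_scope.

(* f is total, but its values outside the open set U are irrelevant. *)
Fixpoint Ck (R : realType) (n k : nat) (U : set 'rV[R]_n)
    (f : 'rV[R]_n -> R) : Prop :=
  (forall x, U x -> {for x, continuous f}) /\
  if k is k'.+1 then
    forall i : 'I_n,
      (forall x, U x -> derivable f x (delta_mx 0 i)) /\
      Ck k' U ('D_(delta_mx 0 i) f)
  else True.

Definition Cinfty (R : realType) (n : nat) (U : set 'rV[R]_n)
  (f : 'rV[R]_n -> R) : Prop := forall k, Ck k U f.

Section CkTheory.
Variables (R : realType) (n : nat) (U : set 'rV[R]_n).
Hypothesis oU : open U.
Implicit Types f g : 'rV[R]_n -> R.

Let eq_near f g : (forall x, U x -> f x = g x) ->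
  forall x, U x -> \forall y \near x, f y = g y.
Proof.
move=> fg x Ux; have nU : nbhs x U by exact: open_nbhs_nbhs.
by near=> y; apply: fg; near: y.
Unshelve. all: by end_near. Qed.

Lemma Ck_ext k f g : (forall x, U x -> f x = g x) -> Ck k U f -> Ck k U g.
Proof.
elim: k f g => [|k IH] f g fg /= [cf df].
  split=> // x Ux; rewrite /prop_for/continuous_at/= -(fg _ Ux).
  exact: cvg_trans (near_eq_cvg (eq_near fg Ux)) (cf x Ux).
split=> [x Ux|i].
  rewrite /prop_for/continuous_at/= -(fg _ Ux).
  exact: cvg_trans (near_eq_cvg (eq_near fg Ux)) (cf x Ux).
have [dfi Cfi] := df i; split=> [x Ux|].
  exact: near_eq_derivable (eq_near fg Ux) (dfi x Ux).
by apply: IH Cfi => x Ux; rewrite (near_eq_derive _ (eq_near fg Ux)).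
Qed.

Lemma Ck_cont k f : Ck k U f -> forall x, U x -> {for x, continuous f}.
Proof. by case: k => [|k] []. Qed.

Lemma CkW k f : Ck k.+1 U f -> Ck k U f.
Proof.
elim: k f => [|k IH] f [cf df]; first by split.
by split=> // i; have [dfi /IH] := df i; split.
Qed.

Lemma Ck_cst k (c : R) : Ck k U (fun=> c).
Proof.
elim: k c => [|k IH] c; (split=> //; first by move=> x _; exact: cst_continuous).
move=> i; split=> [x _|]; first exact: (derivable_cst c x _).
by apply: Ck_ext (IH 0) => x _; rewrite derive_cst.
Qed.

Lemma CkD k f g : Ck k U f -> Ck k U g -> Ck k U (f + g).
Proof.
elim: k f g => [|k IH] f g [cf df] [cg dg];
  (split=> //; first by move=> x Ux; exact: (cvgD (cf x Ux) (cg x Ux))).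
move=> i; have [[dfi Cfi] [dgi Cgi]] := (df i, dg i); split=> [x Ux|].
  by apply: derivableD; [exact: dfi|exact: dgi].
apply: Ck_ext (IH _ _ Cfi Cgi) => x Ux.
by rewrite deriveD //; [exact: dfi|exact: dgi].
Qed.

Lemma CkM k f g : Ck k U f -> Ck k U g -> Ck k U (f * g).
Proof.
elim: k f g => [|k IH] f g Cf Cg; have [[cf df] [cg dg]] := (Cf, Cg);
  (split=> //; first by move=> x Ux; exact: (cvgM (cf x Ux) (cg x Ux))).
move=> i; have [[dfi Cfi] [dgi Cgi]] := (df i, dg i); split=> [x Ux|].
  by apply: derivableM; [exact: dfi|exact: dgi].
apply: Ck_ext (CkD (IH _ _ (CkW Cf) Cgi) (IH _ _ (CkW Cg) Cfi)) => x Ux.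
by rewrite deriveM //; [exact: dfi|exact: dgi].
Qed.

End CkTheory.

Record chart (R : realType) (n : nat) (T : topologicalType) := Chart {
  chart_dom : set T;
  chart_map : T -> 'rV[R]_n;
  chart_inv : 'rV[R]_n -> T;
  open_chart_dom : open chart_dom;
  open_chart_img : open (chart_map @` chart_dom);
  chart_mapK : forall p, chart_dom p -> chart_inv (chart_map p) = p;
  continuous_chart_map :
    forall p, chart_dom p -> {for p, continuous chart_map};
  continuous_chart_inv :
    forall x, (chart_map @` chart_dom) x -> {for x, continuous chart_inv} }.

Record smoothManifold (R : realType) (n : nat) := SmoothManifold {
  manifold_space :> topologicalType;
  manifold_hausdorff : hausdorff_space manifold_space;
  manifold_second_countable : @second_countable manifold_space;
  atlas : set (chart R n manifold_space);
  atlas_cover : forall p, exists2 c, atlas c & chart_dom c p;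
  atlas_compat : forall c c', atlas c -> atlas c' -> forall i : 'I_n,
    Cinfty (chart_map c @` (chart_dom c `&` chart_dom c'))
      (fun x => chart_map c' (chart_inv c x) 0 i) }.

Section SmoothFunctions.
Variables (R : realType) (n : nat) (M : smoothManifold R n).

Definition smooth (f : M -> R) : Prop := forall c, atlas c ->
  Cinfty (chart_map c @` chart_dom c) (f \o chart_inv c).

Definition smooth_pred : {pred M -> R} := fun f => `[< smooth f >].

Lemma smooth_cst_subproof (a : R) : smooth (fun=> a).
Proof. by move=> c _ k; apply: Ck_cst; exact: open_chart_img. Qed.

Lemma smoothD f g : smooth f -> smooth g -> smooth (f + g).
Proof.
by move=> sf sg c ac k; apply: CkD (sf c ac k) (sg c ac k);
  exact: open_chart_img.
Qed.

Lemma smoothM f g : smooth f -> smooth g -> smooth (f * g).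
Proof.
by move=> sf sg c ac k; apply: CkM (sf c ac k) (sg c ac k);
  exact: open_chart_img.
Qed.

Lemma smoothN f : smooth f -> smooth (- f).
Proof.
move=> sf; have -> : - f = (fun=> -1) * f by apply/funext => p; rewrite /= fctE mulN1r.
exact: smoothM (smooth_cst_subproof _) sf.
Qed.

Lemma smooth_subring : subring_closed smooth_pred.
Proof.
split=> [|f g|f g].
- by apply/asboolP; exact: smooth_cst_subproof.
- by move=> /asboolP sf /asboolP sg; apply/asboolP; exact: smoothD (smoothN sg).
- by move=> /asboolP sf /asboolP sg; apply/asboolP; exact: smoothM.
Qed.

HB.instance Definition _ :=
  GRing.isSubringClosed.Build (M -> R) smooth_pred smooth_subring.

Record smoothFun := SmoothFun {
  smooth_val :> M -> R;
  smooth_valP : smooth_val \in smooth_pred }.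

HB.instance Definition _ := [isSub for smooth_val].
HB.instance Definition _ := [Choice of smoothFun by <:].
HB.instance Definition _ := GRing.SubChoice_isSubComPzRing.Build
  (M -> R) smooth_pred smoothFun smooth_subring.

Definition mk_smooth (f : M -> R) (sf : smooth f) : smoothFun :=
  SmoothFun (introT (asboolP (smooth f)) sf).

Definition smooth_cst (a : R) : smoothFun := mk_smooth (smooth_cst_subproof a).

Lemma smoothFunP (f : smoothFun) : smooth f.
Proof. by have /asboolP := smooth_valP f. Qed.

Lemma smoothFun_eq (f g : smoothFun) : (forall p, f p = g p) -> f = g.
Proof. by move=> fg; apply/val_inj/funext. Qed.

End SmoothFunctions.
Arguments smooth_cst {R n M} a.

Section SmoothFunEval.
Variables (R : realType) (n : nat) (M : smoothManifold R n).
Implicit Types (f g : smoothFun M) (p : M).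

Lemma smooth0E p : (0 : smoothFun M) p = 0. Proof. by []. Qed.
Lemma smooth1E p : (1 : smoothFun M) p = 1. Proof. by []. Qed.
Lemma smoothDE f g p : (f + g) p = f p + g p. Proof. by []. Qed.
Lemma smoothNE f p : (- f) p = - f p. Proof. by []. Qed.
Lemma smoothME f g p : (f * g) p = f p * g p. Proof. by []. Qed.

Definition smoothE := (smooth0E, smooth1E, smoothDE, smoothNE, smoothME).

End SmoothFunEval.

Section TangentSpace.
Variables (R : realType) (n : nat) (M : smoothManifold R n).

(* Tangent vectors at p are the derivations of C^oo(M) at p. *)
Record tangent (p : M) := Tangent {
  tangent_val :> smoothFun M -> R;
  tangent_linear : forall (a : R) f g,
    tangent_val (smooth_cst a * f + g) = a * tangent_val f + tangent_val g;
  tangent_leibniz : forall f g,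
    tangent_val (f * g) = tangent_val f * g p + f p * tangent_val g }.

Lemma tangent_eq p (u v : tangent p) : (forall f, u f = v f) -> u = v.
Proof.
case: u v => [u lu du] [v lv dv] /= /funext uv.
by case: _ / uv in lv dv *; congr Tangent; exact: Prop_irrelevance.
Qed.

HB.instance Definition _ p := gen_eqMixin (tangent p).
HB.instance Definition _ p := gen_choiceMixin (tangent p).

Program Definition tangent_zero p : tangent p := @Tangent p (fun=> 0) _ _.
Next Obligation. by move=> p a f g; rewrite mulr0 addr0. Qed.
Next Obligation. by move=> p f g; rewrite mul0r mulr0 addr0. Qed.

Program Definition tangent_add p (u v : tangent p) : tangent p :=
  @Tangent p (fun f => u f + v f) _ _.
Next Obligation.
by move=> p u v a f g /=; rewrite !tangent_linear mulrDr addrACA.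
Qed.
Next Obligation.
by move=> p u v f g /=; rewrite !tangent_leibniz mulrDr mulrDl addrACA.
Qed.

Program Definition tangent_opp p (u : tangent p) : tangent p :=
  @Tangent p (fun f => - u f) _ _.
Next Obligation. by move=> p u a f g /=; rewrite tangent_linear opprD mulrN. Qed.
Next Obligation.
by move=> p u f g /=; rewrite tangent_leibniz opprD mulrN mulNr.
Qed.

Program Definition tangent_scale p (c : R) (u : tangent p) : tangent p :=
  @Tangent p (fun f => c * u f) _ _.
Next Obligation.
by move=> p c u a f g /=; rewrite tangent_linear mulrDr mulrCA.
Qed.
Next Obligation.
by move=> p c u f g /=; rewrite tangent_leibniz mulrDr mulrA (mulrCA c).
Qed.

Section TangentLmodule.
Variable p : M.

Lemma tangent_addA : associative (@tangent_add p).
Proof. by move=> u v w; apply: tangent_eq => f /=; rewrite addrA. Qed.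
Lemma tangent_addC : commutative (@tangent_add p).
Proof. by move=> u v; apply: tangent_eq => f /=; rewrite addrC. Qed.
Lemma tangent_add0 : left_id (tangent_zero p) (@tangent_add p).
Proof. by move=> u; apply: tangent_eq => f /=; rewrite add0r. Qed.
Lemma tangent_addN :
  left_inverse (tangent_zero p) (@tangent_opp p) (@tangent_add p).
Proof. by move=> u; apply: tangent_eq => f /=; rewrite addNr. Qed.

HB.instance Definition _ := GRing.isZmodule.Build (tangent p)
  tangent_addA tangent_addC tangent_add0 tangent_addN.

Lemma tangent_scaleA a b (u : tangent p) :
  tangent_scale a (tangent_scale b u) = tangent_scale (a * b) u.
Proof. by apply: tangent_eq => f /=; rewrite mulrA. Qed.
Lemma tangent_scale1 : left_id 1 (@tangent_scale p).
Proof. by move=> u; apply: tangent_eq => f /=; rewrite mul1r. Qed.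
Lemma tangent_scaleDr : right_distributive (@tangent_scale p) +%R.
Proof. by move=> a u v; apply: tangent_eq => f /=; rewrite mulrDr. Qed.
Lemma tangent_scaleDl u : {morph (@tangent_scale p)^~ u : a b / a + b}.
Proof. by move=> a b; apply: tangent_eq => f /=; rewrite mulrDl. Qed.

HB.instance Definition _ := GRing.Zmodule_isLmodule.Build R (tangent p)
  tangent_scaleA tangent_scale1 tangent_scaleDr tangent_scaleDl.

End TangentLmodule.
End TangentSpace.

Section VectorFields.
Variables (R : realType) (n : nat) (M : smoothManifold R n).

Record vfield := VField {
  vfield_val :> forall p : M, tangent p;
  vfield_smooth :
    forall f : smoothFun M, smooth (fun p => vfield_val p f) }.

Lemma vfield_eq (X Y : vfield) : (forall p, X p = Y p) -> X = Y.
Proof.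
case: X Y => [X sX] [Y sY] /= eXY.
have XY : X = Y by exact: functional_extensionality_dep.
by case: _ / XY in sY eXY *; congr VField; exact: Prop_irrelevance.
Qed.

HB.instance Definition _ := gen_eqMixin vfield.
HB.instance Definition _ := gen_choiceMixin vfield.

Definition vfield_zero : vfield :=
  @VField (fun p => 0) (fun=> smooth_cst_subproof 0).

Definition vfield_add (X Y : vfield) : vfield :=
  @VField (fun p => X p + Y p)
    (fun f => smoothD (vfield_smooth X f) (vfield_smooth Y f)).

Definition vfield_opp (X : vfield) : vfield :=
  @VField (fun p => - X p) (fun f => smoothN (vfield_smooth X f)).

Definition vfield_scale (h : smoothFun M) (X : vfield) : vfield :=
  @VField (fun p => h p *: X p)
    (fun f => smoothM (smoothFunP h) (vfield_smooth X f)).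

Lemma vfield_addA : associative vfield_add.
Proof. by move=> X Y Z; apply: vfield_eq => p /=; rewrite addrA. Qed.
Lemma vfield_addC : commutative vfield_add.
Proof. by move=> X Y; apply: vfield_eq => p /=; rewrite addrC. Qed.
Lemma vfield_add0 : left_id vfield_zero vfield_add.
Proof. by move=> X; apply: vfield_eq => p /=; rewrite add0r. Qed.
Lemma vfield_addN : left_inverse vfield_zero vfield_opp vfield_add.
Proof. by move=> X; apply: vfield_eq => p /=; rewrite addNr. Qed.

HB.instance Definition _ := GRing.isZmodule.Build vfield
  vfield_addA vfield_addC vfield_add0 vfield_addN.

Lemma vfield_scaleA a b X :
  vfield_scale a (vfield_scale b X) = vfield_scale (a * b) X.
Proof. by apply: vfield_eq => p; exact: scalerA. Qed.
Lemma vfield_scale1 : left_id 1 vfield_scale.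
Proof. by move=> X; apply: vfield_eq => p; exact: scale1r. Qed.
Lemma vfield_scaleDr : right_distributive vfield_scale +%R.
Proof. by move=> a X Y; apply: vfield_eq => p /=; rewrite scalerDr. Qed.
Lemma vfield_scaleDl X : {morph vfield_scale^~ X : a b / a + b}.
Proof. by move=> a b; apply: vfield_eq => p; exact: scalerDl. Qed.

HB.instance Definition _ := GRing.Zmodule_isLmodule.Build (smoothFun M) vfield
  vfield_scaleA vfield_scale1 vfield_scaleDr vfield_scaleDl.

Definition vder (X : vfield) (f : smoothFun M) : smoothFun M :=
  mk_smooth (vfield_smooth X f).

Lemma vder_linear X (a : R) f g :
  vder X (smooth_cst a * f + g) = smooth_cst a * vder X f + vder X g.
Proof. by apply: smoothFun_eq => p; rewrite !smoothE /= tangent_linear. Qed.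

Lemma vder_leibniz X f g : vder X (f * g) = vder X f * g + f * vder X g.
Proof. by apply: smoothFun_eq => p; rewrite !smoothE /= tangent_leibniz. Qed.

Program Definition bracket_at (X Y : vfield) (p : M) : tangent p :=
  @Tangent R n M p (fun f => X p (vder Y f) - Y p (vder X f)) _ _.
Next Obligation.
by move=> X Y p a f g /=; rewrite !vder_linear !tangent_linear mulrBr opprD addrACA.
Qed.
Next Obligation.
move=> X Y p f g /=; rewrite !vder_leibniz.
have tD (u : tangent p) k l : u (k + l) = u k + u l.
  have -> : k + l = smooth_cst 1 * k + l.
    by apply: smoothFun_eq => q; rewrite !smoothE mul1r.
  by rewrite tangent_linear mul1r.
by rewrite !tD !tangent_leibniz /=; ring.
Qed.

Lemma bracket_smooth X Y (f : smoothFun M) : smooth (fun p => bracket_at X Y p f).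
Proof. exact: (smoothFunP (vder X (vder Y f) - vder Y (vder X f))). Qed.

Definition bracket (X Y : vfield) : vfield := VField (bracket_smooth X Y).

End VectorFields.

Section RiemannianGeometry.
Variables (R : realType) (n : nat) (M : smoothManifold R n).

Record riemannianMetric := RiemannianMetric {
  metric_at : forall p : M, tangent p -> tangent p -> R;
  metric_linear : forall p (a : R) (u v w : tangent p),
    metric_at (a *: u + v) w = a * metric_at u w + metric_at v w;
  metric_sym : forall p (u v : tangent p), metric_at u v = metric_at v u;
  metric_posdef : forall p (u : tangent p), u != 0 -> 0 < metric_at u u;
  metric_smooth : forall X Y : vfield M, smooth (fun p => metric_at (X p) (Y p)) }.

Definition metric (g : riemannianMetric) (X Y : vfield M) : smoothFun M :=
  mk_smooth (metric_smooth g X Y).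

Record levi_civita (g : riemannianMetric)
    (nabla : vfield M -> vfield M -> vfield M) : Prop := LeviCivita {
  lc_addl : forall X Y Z, nabla (X + Y) Z = nabla X Z + nabla Y Z;
  lc_scalel : forall f X Z, nabla (f *: X) Z = f *: nabla X Z;
  lc_addr : forall X Y Z, nabla X (Y + Z) = nabla X Y + nabla X Z;
  lc_leibniz : forall X f Y,
    nabla X (f *: Y) = vder X f *: Y + f *: nabla X Y;
  lc_torsion_free : forall X Y, nabla X Y - nabla Y X = bracket X Y;
  lc_metric : forall X Y Z,
    vder X (metric g Y Z) = metric g (nabla X Y) Z + metric g Y (nabla X Z) }.

Record almostContactMetric := AlmostContactMetric {
  acm_metric : riemannianMetric;
  phi_at : forall p : M, {linear tangent p -> tangent p};
  phi_smooth : forall (X : vfield M) (f : smoothFun M),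
    smooth (fun p => phi_at p (X p) f);
  xi : vfield M;
  eta_at : forall p : M, {scalar tangent p};
  eta_smooth : forall X : vfield M, smooth (fun p => eta_at p (X p));
  phi_phi : forall p (u : tangent p),
    phi_at p (phi_at p u) = - u + eta_at p u *: xi p;
  eta_xi : forall p, eta_at p (xi p) = 1;
  phi_xi : forall p, phi_at p (xi p) = 0;
  eta_phi : forall p (u : tangent p), eta_at p (phi_at p u) = 0;
  metric_phi : forall p (u v : tangent p),
    metric_at acm_metric (phi_at p u) (phi_at p v) =
    metric_at acm_metric u v - eta_at p u * eta_at p v }.

Definition phi (S : almostContactMetric) (X : vfield M) : vfield M :=
  VField (phi_smooth S X).

Definition eta (S : almostContactMetric) (X : vfield M) : smoothFun M :=
  mk_smooth (eta_smooth S X).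

Definition trans_sasakian (S : almostContactMetric)
    (nabla : vfield M -> vfield M -> vfield M) (alpha beta : smoothFun M) :=
  let g := metric (acm_metric S) in
  forall X Y : vfield M,
    nabla X (phi S Y) - phi S (nabla X Y) =
    alpha *: (g X Y *: xi S - eta S Y *: X) +
    beta *: (g (phi S X) Y *: xi S - eta S Y *: phi S X).

(* The basis condition at each p is split into orthonormality and spanning. *)
Definition orthonormal_frame (g : riemannianMetric) (e : 'I_n -> vfield M) :=
  (forall i j, metric g (e i) (e j) = (i == j)%:R) /\
  (forall p (u : tangent p), exists a : 'I_n -> R, u = \sum_i a i *: e i p).

End RiemannianGeometry.

Section Complexification.

(* The pair (u, v) stands for u + i v; pairs carry the product Z-module
   structure. *)
Definition cplx (V : zmodType) : zmodType := (V * V)%type.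

Definition cembed (V : zmodType) (u : V) : cplx V := (u, 0).
Definition cconj (V : zmodType) (z : cplx V) : cplx V := (z.1, - z.2).
Definition cmuli (V : zmodType) (z : cplx V) : cplx V := (- z.2, z.1).

Definition cext (U V : zmodType) (A : U -> V) (z : cplx U) : cplx V :=
  (A z.1, A z.2).

Definition cext2 (U V W : zmodType) (B : U -> V -> W)
    (z : cplx U) (w : cplx V) : cplx W :=
  (B z.1 w.1 - B z.2 w.2, B z.1 w.2 + B z.2 w.1).

Definition cvalue (R : realType) (n : nat) (M : smoothManifold R n)
  (f : cplx (smoothFun M)) (p : M) : R[i] := (f.1 p +i* f.2 p)%C.

End Complexification.

Section NewmanPenrose.
Variables (R : realType) (M : smoothManifold R 3) (S : almostContactMetric M).
Variable nabla : vfield M -> vfield M -> vfield M.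

Definition cmetric := cext2 (metric (acm_metric S)).
Definition cnabla := cext2 nabla.
Definition cbracket := cext2 (@bracket R 3 M).
Definition cder := cext2 (@vder R 3 M).

Definition curvature (X Y Z : cplx (vfield M)) : cplx (vfield M) :=
  cnabla X (cnabla Y Z) - cnabla Y (cnabla X Z) - cnabla (cbracket X Y) Z.

Definition curvature4 (X Y Z W : cplx (vfield M)) : cplx (smoothFun M) :=
  cmetric (curvature X Y Z) W.

Definition np_vector (e1 e2 : vfield M) : cplx (vfield M) :=
  (smooth_cst (Num.sqrt 2)^-1 *: e1, - (smooth_cst (Num.sqrt 2)^-1 *: e2)).

Definition np_frame (e1 e2 : vfield M) : Prop :=
  let d := np_vector e1 e2 in
  [/\ orthonormal_frame (acm_metric S)
         (tnth [tuple e1; e2; xi S]),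
      cext (phi S) d = cmuli d &
      cext (phi S) (cconj d) = - cmuli (cconj d)].

Section SpinCoefficients.
Variables e1 e2 : vfield M.
Let d := np_vector e1 e2.
Let db := cconj d.
Let x := cembed (xi S).

Definition sigma_np := - cmetric d (cnabla d x).
Definition rho_np := cmetric d (cnabla db x).
Definition kappa_np := - cmetric d (cnabla x x).
Definition beta_np := cmetric db (cnabla d d).
Definition epsilon_np := cmetric db (cnabla x d).
End SpinCoefficients.

End NewmanPenrose.

(* Main.v *)
(* In the frame (d, db, xi), the trans-Sasakian condition enters only through
   kappa = sigma = 0; together with metric compatibility this gives
     nabla_d d = b d,             nabla_db d = - b^* d - rho xi,
     nabla_xi d = eps d,          nabla_d xi = rho^* d,      nabla_xi xi = 0
   and the complex conjugate equations, with eps^* = - eps.  Substituting into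
   the definition of R yields the first three formulas, and
   R(d, xi, xi, db) = - xi(rho^* ) - (rho^* )^2.  The xi-component of the first
   Bianchi identity on (d, db, xi) says that xi(rho) + rho^2 is real, which
   turns this into the fourth formula. *)
Require Import Defs.
From mathcomp Require Import all_boot all_order all_algebra complex ring.
From mathcomp Require Import all_classical all_reals all_analysis.
Import Order.TTheory GRing.Theory Num.Theory.
Local Open Scope ring_scope.
Set Implicit Arguments.
Unset Strict Implicit.
Unset Printing Implicit Defensive.

(** * Complex-bilinear extension of biadditive maps *)

Section Complexified.

Lemma cplx_eq (V : zmodType) (z w : cplx V) : z.1 = w.1 -> z.2 = w.2 -> z = w.
Proof. by case: z w => [a b] [c e] /= -> ->. Qed.

(** [metric], [bracket] and [nabla] are bare functions, so their behaviour at 0 and at opposites is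
    recovered from additivity by cancellation. *)
Lemma biadditive0l (U V W : zmodType) (B : U -> V -> W) :
  (forall x y z, B (x + y) z = B x z + B y z) -> forall z, B 0 z = 0.
Proof. by move=> BD z; apply: (addrI (B 0 z)); rewrite -BD !addr0. Qed.

Lemma biadditiveNl (U V W : zmodType) (B : U -> V -> W) :
  (forall x y z, B (x + y) z = B x z + B y z) -> forall x z, B (- x) z = - B x z.
Proof.
by move=> BD x z; apply: (addrI (B x z)); rewrite -BD !subrr (biadditive0l BD).
Qed.

Variables (U V W : zmodType) (B : U -> V -> W).
Hypothesis BDl : forall x y z, B (x + y) z = B x z + B y z.
Hypothesis BDr : forall x y z, B x (y + z) = B x y + B x z.

Let BDr' x y z : (fun a b => B b a) (x + y) z = B z x + B z y.
Proof. exact: BDr. Qed.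

Lemma cext2Dl x y z : cext2 B (x + y) z = cext2 B x z + cext2 B y z.
Proof.
case: x y z => [x1 x2] [y1 y2] [z1 z2]; apply: cplx_eq => /=; rewrite !BDl.
  by rewrite opprD addrACA.
by rewrite addrACA.
Qed.

Lemma cext2Dr x y z : cext2 B x (y + z) = cext2 B x y + cext2 B x z.
Proof.
case: x y z => [x1 x2] [y1 y2] [z1 z2]; apply: cplx_eq => /=; rewrite !BDr.
  by rewrite opprD addrACA.
by rewrite addrACA.
Qed.

Lemma cext2Nl x z : cext2 B (- x) z = - cext2 B x z.
Proof. exact: (biadditiveNl cext2Dl). Qed.

Lemma cext2Nr x z : cext2 B x (- z) = - cext2 B x z.
Proof.
exact: (@biadditiveNl _ _ _ (fun a b => cext2 B b a)
                            (fun x y z => cext2Dr z x y)).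
Qed.

(** [B] is real, so its extension commutes with conjugation; half of the frame equations below
    follow from the other half in this way. *)
Lemma cext2_conj x y : cext2 B (cconj x) (cconj y) = cconj (cext2 B x y).
Proof.
have Nr a b : B a (- b) = - B a b by exact: (biadditiveNl BDr').
have Nl a b : B (- a) b = - B a b by exact: (biadditiveNl BDl).
by apply: cplx_eq => /=; rewrite ?Nr ?Nl ?opprK // opprD.
Qed.

End Complexified.

(** * Derivations, brackets and the metric on real fields *)

Section SmoothAlgebra.
Variables (R : realType) (n : nat) (M : smoothManifold R n).
Implicit Types (X Y Z : vfield M) (f h : smoothFun M) (p : M).

Lemma vfield_ext X Y : (forall p f, X p f = Y p f) -> X = Y.
Proof. by move=> XY; apply: vfield_eq => p; apply: tangent_eq => f. Qed.

Lemma vfieldDE X Y p f : (X + Y) p f = X p f + Y p f. Proof. by []. Qed.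
Lemma vfieldNE X p f : (- X) p f = - X p f. Proof. by []. Qed.
Lemma vfieldZE h X p f : (h *: X) p f = h p * X p f. Proof. by []. Qed.
Lemma vfield0E p f : (0 : vfield M) p f = 0. Proof. by []. Qed.
Definition vfieldE := (vfieldDE, vfieldNE, vfieldZE, vfield0E).

Lemma vderDl X Y f : vder (X + Y) f = vder X f + vder Y f.
Proof. by apply: smoothFun_eq. Qed.

Lemma tangentD p (v : tangent p) f h : v (f + h) = v f + v h.
Proof.
have e1 k : smooth_cst 1 * k = k by apply: smoothFun_eq => q; rewrite smoothE mul1r.
by rewrite -[f in LHS]e1 tangent_linear mul1r.
Qed.

Lemma tangentN p (v : tangent p) f : v (- f) = - v f.
Proof.
have v0 : v 0 = 0 by apply: (addrI (v 0)); rewrite -tangentD !addr0.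
by apply: (addrI (v f)); rewrite -tangentD !subrr.
Qed.

Lemma vderDr X f h : vder X (f + h) = vder X f + vder X h.
Proof. by apply: smoothFun_eq => p; exact: tangentD. Qed.

Lemma vderNr X f : vder X (- f) = - vder X f.
Proof.
exact: (@biadditiveNl _ _ _ (fun a b => vder b a) (fun a b x => vderDr x a b)).
Qed.

Lemma vder0r X : vder X 0 = 0.
Proof. by apply: (addrI (vder X 0)); rewrite -vderDr !addr0. Qed.

Lemma vder1r X : vder X 1 = 0.
Proof.
have := vder_leibniz X 1 1; rewrite !mulr1 mul1r => /eqP.
by rewrite -subr_eq0 opprD addrA subrr sub0r oppr_eq0 => /eqP.
Qed.

Lemma bracketE X Y p f : bracket X Y p f = X p (vder Y f) - Y p (vder X f).
Proof. by []. Qed.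

Lemma bracketDl X Y Z : bracket (X + Y) Z = bracket X Z + bracket Y Z.
Proof.
apply: vfield_ext => p f; rewrite !vfieldE !bracketE !vfieldE vderDl.
by rewrite tangentD; ring.
Qed.

Lemma bracketDr X Y Z : bracket X (Y + Z) = bracket X Y + bracket X Z.
Proof.
apply: vfield_ext => p f; rewrite !vfieldE !bracketE !vfieldE vderDl.
by rewrite tangentD; ring.
Qed.

Lemma vder_bracket X Y f :
  vder (bracket X Y) f = vder X (vder Y f) - vder Y (vder X f).
Proof. by apply: smoothFun_eq. Qed.

Variable g : riemannianMetric M.

Lemma metricDl X Y Z : metric g (X + Y) Z = metric g X Z + metric g Y Z.
Proof.
apply: smoothFun_eq => p /=.
by have := metric_linear g 1 (X p) (Y p) (Z p); rewrite scale1r mul1r.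
Qed.

Lemma metricC X Y : metric g X Y = metric g Y X.
Proof. by apply: smoothFun_eq => p; exact: Defs.metric_sym. Qed.

Lemma metricDr X Y Z : metric g X (Y + Z) = metric g X Y + metric g X Z.
Proof. by rewrite metricC metricDl !(metricC X). Qed.

Lemma metricZl f X Y : metric g (f *: X) Y = f * metric g X Y.
Proof.
apply: smoothFun_eq => p; rewrite smoothE.
(* [metric_linear] speaks of [a *: u + v] only; the zero field is inserted as [v]. *)
rewrite -[RHS]addr0 -[X in _ + X](smooth0E p) -(biadditive0l metricDl Y) /=.
by rewrite -metric_linear addr0.
Qed.

Lemma metricZr f X Y : metric g X (f *: Y) = f * metric g X Y.
Proof. by rewrite metricC metricZl metricC. Qed.

Lemma metricNl X Y : metric g (- X) Y = - metric g X Y.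
Proof. exact: (biadditiveNl metricDl). Qed.

Lemma metricNr X Y : metric g X (- Y) = - metric g X Y.
Proof. by rewrite metricC metricNl metricC. Qed.

Lemma metric0l Y : metric g 0 Y = 0.
Proof. exact: (biadditive0l metricDl). Qed.

End SmoothAlgebra.

(** * Complex scalars, evaluation at points, and the Jacobi identity *)

Section ComplexFields.
Variables (R : realType) (n : nat) (M : smoothManifold R n).
Local Notation C := (cplx (smoothFun M)).
Local Notation V := (cplx (vfield M)).
Implicit Types (f h : C) (X Y Z : V) (p : M).

(** [cplx] carries only an additive structure, so the action of complex functions on complex fields
    is a separate operation. *)
Definition cplx_scale f X : V :=
  cext2 (fun (h : smoothFun M) (u : vfield M) => h *: u) f X.

Lemma cvalue0 p : cvalue (0 : C) p = 0. Proof. by []. Qed.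
Lemma cvalueN f p : cvalue (- f) p = - cvalue f p. Proof. by []. Qed.

Lemma cvalue_eq f h : (forall p, cvalue f p = cvalue h p) -> f = h.
Proof. by move=> E; apply: cplx_eq; apply: smoothFun_eq => p; case: (E p). Qed.

Lemma cvalue_conj f p : cvalue (cconj f) p = (cvalue f p)^*.
Proof. by []. Qed.

Lemma cconjK (W : zmodType) (z : cplx W) : cconj (cconj z) = z.
Proof. by apply: cplx_eq => //=; rewrite opprK. Qed.

Lemma cconjD (W : zmodType) (z w : cplx W) : cconj (z + w) = cconj z + cconj w.
Proof. by apply: cplx_eq => //=; rewrite opprD. Qed.

Lemma cconjN (W : zmodType) (z : cplx W) : cconj (- z) = - cconj z.
Proof. by apply: cplx_eq. Qed.

Lemma cplx_scale_conj f X : cconj (cplx_scale f X) = cplx_scale (cconj f) (cconj X).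
Proof. by rewrite /cplx_scale cext2_conj // => *; rewrite ?scalerDl ?scalerDr. Qed.

Lemma cplx_scaleNl f X : cplx_scale (- f) X = - cplx_scale f X.
Proof. by rewrite /cplx_scale cext2Nl // => *; rewrite ?scalerDl ?scalerDr. Qed.

Lemma cvalue_metric_scale g f X Y p :
  cvalue (cext2 (metric g) (cplx_scale f X) Y) p =
  cvalue f p * cvalue (cext2 (metric g) X Y) p.
Proof.
have -> : cext2 (metric g) (cplx_scale f X) Y =
    cext2 (fun a b : smoothFun M => a * b) f (cext2 (metric g) X Y).
  case: f X Y => [a b] [X X'] [Y Y'].
  by apply: cplx_eq => /=; rewrite !(metricDl, metricNl, metricZl); ring.
by apply/eqP; rewrite eq_complex /= !eqxx.
Qed.

(** Brackets act on functions as commutators, and the twelve triple derivatives cancel in pairs. *)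
Lemma jacobi (X Y Z : vfield M) : bracket X (bracket Y Z) + bracket Y (bracket Z X)
  + bracket Z (bracket X Y) = 0 :> vfield M.
Proof.
apply: vfield_ext => p f.
rewrite !vfieldE !bracketE !vder_bracket !tangentD !tangentN.
ring.
Qed.

(** By trilinearity the real and imaginary parts are signed sums of four real Jacobi expressions
    [J]. *)
Lemma cjacobi X Y Z : let B := cext2 (@bracket R n M) in
  B X (B Y Z) + B Y (B Z X) + B Z (B X Y) = 0.
Proof.
move=> B; rewrite /B {B}.
have bNl A D : bracket (- A) D = - bracket A D :> vfield M.
  exact: (biadditiveNl (@bracketDl _ _ _)).
have bNr A D : bracket A (- D) = - bracket A D :> vfield M.
  exact: (@biadditiveNl _ _ _ (fun a b => bracket b a)
                              (fun a b x => bracketDr x a b)).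
case: X Y Z => [X X'] [Y Y'] [Z Z'].
pose J (A B D : vfield M) := bracket A (bracket B D) + bracket B (bracket D A)
  + bracket D (bracket A B).
have J0 A B D : J A B D = 0 by exact: jacobi.
apply: cplx_eq => /=; rewrite !(bracketDr, bNr).
  transitivity (J X Y Z - J X Y' Z' - J X' Y Z' - J X' Y' Z).
    by apply: vfield_ext => p f; rewrite /J !vfieldE; ring.
  by rewrite !J0 !subr0.
transitivity (J X Y Z' + J X Y' Z + J X' Y Z - J X' Y' Z').
  by apply: vfield_ext => p f; rewrite /J !vfieldE; ring.
by rewrite !J0 !addr0 subr0.
Qed.

End ComplexFields.

(** * The complexified Levi-Civita connection and the first Bianchi identity *)

Section ComplexLeviCivita.
Variables (R : realType) (n : nat) (M : smoothManifold R n).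
Variables (g : riemannianMetric M) (nabla : vfield M -> vfield M -> vfield M).
Hypothesis LC : levi_civita g nabla.
Local Notation G := (cext2 (metric g)).
Local Notation N := (cext2 nabla).
Local Notation D := (cext2 (@vder R n M)).
Implicit Types (f : cplx (smoothFun M)) (X Y Z : cplx (vfield M)).

Lemma cmetricDl X Y Z : G (X + Y) Z = G X Z + G Y Z.
Proof. exact: (cext2Dl (@metricDl _ _ _ g)). Qed.

Lemma cmetricNl X Y : G (- X) Y = - G X Y.
Proof. exact: (cext2Nl (@metricDl _ _ _ g)). Qed.

Lemma cmetric0l Y : G 0 Y = 0.
Proof. exact: (biadditive0l cmetricDl). Qed.

Lemma cmetric_conj X Y : G (cconj X) (cconj Y) = cconj (G X Y).
Proof. exact: (cext2_conj (@metricDl _ _ _ g) (@metricDr _ _ _ g)). Qed.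

Lemma cmetricC X Y : G X Y = G Y X.
Proof.
by apply: cplx_eq => /=; rewrite !(metricC g X.1) !(metricC g X.2) // addrC.
Qed.

Lemma cnablaDl X Y Z : N (X + Y) Z = N X Z + N Y Z.
Proof. exact: (cext2Dl (lc_addl LC)). Qed.

Lemma cnablaDr X Y Z : N X (Y + Z) = N X Y + N X Z.
Proof. exact: (cext2Dr (lc_addr LC)). Qed.

Lemma cnablaNl X Y : N (- X) Y = - N X Y.
Proof. exact: (cext2Nl (lc_addl LC)). Qed.

Lemma cnablaNr X Y : N X (- Y) = - N X Y.
Proof. exact: (cext2Nr (lc_addr LC)). Qed.

Lemma cnabla0r X : N X 0 = 0.
Proof. by apply: (addrI (N X 0)); rewrite -cnablaDr !addr0. Qed.

Lemma cnabla_conj X Y : N (cconj X) (cconj Y) = cconj (N X Y).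
Proof. exact: (cext2_conj (lc_addl LC) (lc_addr LC)). Qed.

Lemma nablaNl (X Y : vfield M) : nabla (- X) Y = - nabla X Y.
Proof. exact: (biadditiveNl (lc_addl LC)). Qed.

Lemma nabla0r (X : vfield M) : nabla X 0 = 0.
Proof. by apply: (addrI (nabla X 0)); rewrite -(lc_addr LC) !addr0. Qed.

Lemma nabla0l (X : vfield M) : nabla 0 X = 0.
Proof. exact: (biadditive0l (lc_addl LC)). Qed.

Lemma cnablaZl f X Y : N (cplx_scale f X) Y = cplx_scale f (N X Y).
Proof.
apply: cplx_eq => /=; rewrite !(lc_addl LC) !nablaNl !(lc_scalel LC);
  by apply: vfield_ext => p h; rewrite !vfieldE; ring.
Qed.

Lemma cnablaZr f X Y :
  N X (cplx_scale f Y) = cplx_scale (D X f) Y + cplx_scale f (N X Y).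
Proof.
have Nr (A B : vfield M) : nabla A (- B) = - nabla A B.
  by apply: (addrI (nabla A B)); rewrite -(lc_addr LC) !subrr nabla0r.
apply: cplx_eq => /=; rewrite !(lc_addr LC) !Nr !(lc_leibniz LC);
  by apply: vfield_ext => p h; rewrite !vfieldE !smoothE; ring.
Qed.

(** Torsion-freeness; it trades every bracket in the curvature for covariant derivatives. *)
Lemma cbracketE X Y : cext2 (@bracket R n M) X Y = N X Y - N Y X.
Proof.
apply: cplx_eq => /=; rewrite -!(lc_torsion_free LC);
  by apply: vfield_ext => p h; rewrite !vfieldE; ring.
Qed.

Lemma cder_metric X Y Z : D X (G Y Z) = G (N X Y) Z + G Y (N X Z).
Proof.
apply: cplx_eq => /=;
  rewrite !vderDr !vderNr !(lc_metric LC);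
  rewrite !(metricDl, metricDr, metricNl, metricNr); ring.
Qed.

(** Metric compatibility, in the form used for frame fields, whose products are constant. *)
Lemma cnabla_skew X Y Z : D X (G Y Z) = 0 -> G (N X Y) Z = - G Y (N X Z).
Proof. by rewrite cder_metric => /eqP; rewrite addr_eq0 => /eqP. Qed.

(** Once torsion-freeness has removed all brackets, the cyclic curvature sum and the Jacobi sum have
    the same terms. *)
Lemma cbianchi X Y Z :
  let Rm X Y Z := N X (N Y Z) - N Y (N X Z) - N (cext2 (@bracket R n M) X Y) Z in
  Rm X Y Z + Rm Y Z X + Rm Z X Y = 0.
Proof.
move=> Rm; rewrite -(cjacobi X Y Z) !(cbracketE _ (_ _ _)) /Rm.
rewrite [in LHS](cbracketE Y Z) [in LHS](cbracketE Z X) [in LHS](cbracketE X Y).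
rewrite !cbracketE !(cnablaDl, cnablaNl, cnablaDr, cnablaNr).
by apply: cplx_eq; apply: vfield_ext => p h /=; ring.
Qed.

End ComplexLeviCivita.

(** * The frame: products, expansions and the action of [phi] *)

Section NewmanPenroseFrame.
Variables (R : realType) (M : smoothManifold R 3) (S : almostContactMetric M).
Variables (e1 e2 : vfield M).
Hypothesis npe : np_frame S e1 e2.
Local Notation g := (metric (acm_metric S)).
Local Notation G := (cext2 (metric (acm_metric S))).
Local Notation c := (smooth_cst (Num.sqrt 2)^-1 : smoothFun M).
Local Notation d := (np_vector e1 e2).
Local Notation db := (cconj (np_vector e1 e2)).
Local Notation x := (cembed (xi S)).
Implicit Types (U W : vfield M).

Lemma smooth_cst_sqrt2 : c * c + c * c = 1.
Proof.
apply: smoothFun_eq => p; rewrite !smoothE /= -invfM -expr2 sqr_sqrtr ?ler0n //.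
by rewrite [RHS]splitr mul1r.
Qed.

Lemma np_frame_metric : 
  [/\ g e1 e1 = 1, g e2 e2 = 1 & g (xi S) (xi S) = 1] /\
  [/\ g e1 e2 = 0, g e1 (xi S) = 0 & g e2 (xi S) = 0].
Proof.
have [[gE _] _ _] := npe.
by split; split; [exact: (gE 0 0) | exact: (gE 1 1) | exact: (gE ord_max ord_max)
  | exact: (gE 0 1) | exact: (gE 0 ord_max) | exact: (gE 1 ord_max)].
Qed.

Lemma np_frame_metricC : [/\ g e2 e1 = 0, g (xi S) e1 = 0 & g (xi S) e2 = 0].
Proof. by have [_ [*]] := np_frame_metric; split; rewrite metricC. Qed.

(** Spanning gives coefficients at each point; orthonormality identifies them with the products. *)
Lemma np_frame_decomp U : U = g e1 U *: e1 + g e2 U *: e2 + g (xi S) U *: xi S.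
Proof.
have [[_ span] _ _] := npe.
have [[g11 g22 g33] [g12 g13 g23]] := np_frame_metric.
have [g21 g31 g32] := np_frame_metricC.
apply: vfield_ext => p f; rewrite !vfieldE.
have [a0 [a1 [a2 Up]]] : exists a0 a1 a2 : R,
    U p = a0 *: e1 p + (a1 *: e2 p + (a2 *: xi S p + 0)).
  have [a ->] := span p (U p).
  by do 3 eexists; rewrite !big_ord_recl big_ord0.
have co (E : vfield M) : g E U p = a0 * g E e1 p + a1 * g E e2 p + a2 * g E (xi S) p.
  (* The empty tail of the sum leaves a zero vector, which is paired as the value at [p] of the zero
     field. *)
  rewrite !(metricC _ E) /= Up !metric_linear.
  have -> : metric_at (acm_metric S) (0 : tangent p) (E p) = 0.
    exact: (congr1 (fun f : smoothFun M => f p) (metric0l (acm_metric S) E)).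
  ring.
rewrite !co g11 g12 g13 g21 g22 g23 g31 g32 g33 !smoothE Up /=.
ring.
Qed.

Lemma phiZ (h : smoothFun M) U : phi S (h *: U) = h *: phi S U.
Proof. by apply: vfield_eq => p; exact: linearZ. Qed.

Lemma phi_np_frame : phi S e1 = e2 /\ phi S e2 = - e1.
Proof.
have [_ H _] := npe.
have E1 : phi S (c *: e1) = - - (c *: e2) := congr1 fst H.
have E2 : phi S (- (c *: e2)) = c *: e1 := congr1 snd H.
have phiN U : phi S (- U) = - phi S U by apply: vfield_eq => p; exact: linearN.
rewrite opprK phiZ in E1; rewrite phiN phiZ in E2.
(* [c + c] is the inverse of [c], so the factor [c] can be cancelled. *)
have s2 : (c + c) * c = 1 by rewrite mulrDl smooth_cst_sqrt2.
have cI U W : c *: U = c *: W -> U = W.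
  by move=> UW; rewrite -[U]scale1r -[W]scale1r -s2 -!scalerA UW.
split; apply: cI; first by [].
by rewrite scalerN -E2 opprK.
Qed.

(** Both fields are in the image of [phi], where [eta] vanishes. *)
Lemma eta_np_frame : eta S e1 = 0 /\ eta S e2 = 0.
Proof.
have [p1 p2] := phi_np_frame.
split; apply: smoothFun_eq => p /=; last by rewrite -p1 /= eta_phi.
by rewrite -[e1]opprK -p2 /= linearN eta_phi oppr0.
Qed.

(** Here [(1, 0)] stands for the complex constant function 1. *)
Lemma np_metric : [/\ G d d = 0, G db db = 0, G d db = (1, 0), G db d = (1, 0) &
  [/\ G x x = (1, 0), G d x = 0, G x d = 0, G db x = 0 & G x db = 0]].
Proof.
have [[g11 g22 g33] [g12 g13 g23]] := np_frame_metric.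
have [g21 g31 g32] := np_frame_metricC.
have s2 := smooth_cst_sqrt2.
have g0l := metric0l (acm_metric S).
have g0r U : g U 0 = 0 by rewrite metricC.
split; [| | | | split]; apply: cplx_eq => /=;
  rewrite ?oppr0 ?opprK !(metricNl, metricNr, metricZl, metricZr, g0l, g0r,
    g11, g22, g33, g12, g13, g23, g21, g31, g32);
  rewrite ?(mulr0, mulr1, oppr0, subr0, addr0, opprK) //.
all: by rewrite ?subrr ?addNr ?opprK.
Qed.

(** The null fields [d] and [db] are dual to each other, so the coefficient along one is the product
    with the other. *)
Lemma np_decomp (V : cplx (vfield M)) :
  V = cplx_scale (G db V) d + cplx_scale (G d V) db + cplx_scale (G x V) x.
Proof.
(* The real expansion has factor 1 along [e1] and [e2], the complex one has [c * c] twice. *)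
have s2 p : 1 = (c p * c p) * 2.
  by rewrite -[LHS](smooth1E p) -smooth_cst_sqrt2 mulr_natr mulr2n.
apply: cplx_eq => /=; rewrite [LHS]np_frame_decomp; apply: vfield_ext => p f;
  rewrite !(metricNl, metricZl, metric0l) !vfieldE !smoothE;
  by rewrite -[X in X + _ = _]mul1r {1}(s2 p); ring.
Qed.

(** * Consequences of the trans-Sasakian condition: kappa = sigma = 0 *)

Variables (nabla : vfield M -> vfield M -> vfield M) (alpha beta : smoothFun M).
Hypothesis LC : levi_civita (acm_metric S) nabla.
Hypothesis tsS : trans_sasakian S nabla alpha beta.
Local Notation N := (cext2 nabla).
Local Notation D := (cext2 (@vder R 3 M)).

(* Obtained from [trans_sasakian] at [Y = xi], paired with [phi W]. *)
Lemma metric_nabla_xi U W : eta S W = 0 ->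
  g (nabla U (xi S)) W =
  - (alpha * (g U (xi S) * g (xi S) (phi S W) - g U (phi S W)) +
     beta * (g (phi S U) (xi S) * g (xi S) (phi S W) - g (phi S U) (phi S W))).
Proof.
move=> etaW.
have phixi : phi S (xi S) = 0 by apply: vfield_eq => p; exact: phi_xi.
have etaxi : eta S (xi S) = 1 by apply: smoothFun_eq => p; exact: eta_xi.
have gphi A : g (phi S A) (phi S W) = g A W.
  have : g (phi S A) (phi S W) = g A W - eta S A * eta S W.
    by apply: smoothFun_eq => p; exact: metric_phi.
  by rewrite etaW mulr0 subr0.
have := tsS U (xi S); rewrite phixi (nabla0r LC) sub0r etaxi !scale1r.
move/(congr1 (fun A => g A (phi S W))).
rewrite metricNl gphi !(metricDl, metricNl, metricZl) => /(congr1 -%R).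
by rewrite opprK => ->.
Qed.

(** The xi-component is half the derivative of g(xi, xi) = 1. In the other two, [metric_nabla_xi]
    leaves only products of xi with [e1] or [e2] and terms in phi(xi) = 0. *)
Lemma nabla_xi_xi : nabla (xi S) (xi S) = 0.
Proof.
have [[g11 g22 g33] [g12 g13 g23]] := np_frame_metric.
have [g21 g31 g32] := np_frame_metricC.
have [h1 h2] := eta_np_frame.
have [p1 p2] := phi_np_frame.
have phixi : phi S (xi S) = 0 by apply: vfield_eq => p; exact: phi_xi.
have gx : g (xi S) (nabla (xi S) (xi S)) = 0.
  have := lc_metric LC (xi S) (xi S) (xi S).
  rewrite g33 vder1r [X in X + _]metricC => E.
  apply: smoothFun_eq => p; have := congr1 (fun f : smoothFun M => f p) E.
  by rewrite !smoothE => /esym/eqP; rewrite -mulr2n mulrn_eq0 /= => /eqP.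
rewrite [LHS]np_frame_decomp gx (metricC _ e1) (metricC _ e2) !metric_nabla_xi //.
rewrite p1 p2 phixi !metric0l !(metricNl, metricNr) g31 g32.
by apply: vfield_ext => p f; rewrite !vfieldE !smoothE; ring.
Qed.

Lemma cnabla_xi_xi : N x x = 0.
Proof.
by apply: cplx_eq; rewrite /= ?nabla_xi_xi !(nabla0r LC) ?(nabla0l LC) ?subr0 ?addr0.
Qed.

(** On the span of [e1] and [e2], g(nabla_U xi, W) = alpha g(U, phi W) + beta g(U, W). At U = W = d
    both terms are multiples of g(d, d) = 0, since phi d = i d. *)
Lemma sigma_np_eq0 : G d (N d x) = 0.
Proof.
have [[g11 g22 g33] [g12 g13 g23]] := np_frame_metric.
have [g21 g31 g32] := np_frame_metricC.
have [h1 h2] := eta_np_frame.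
have [p1 p2] := phi_np_frame.
have gn i j : g (nabla i (xi S)) j = g j (nabla i (xi S)) by rewrite metricC.
apply: cplx_eq; rewrite /= !(nabla0r LC) ?subr0 ?add0r !(nablaNl LC) !(lc_scalel LC);
  rewrite !(metricNl, metricNr, metricZl, metricZr) -!gn !metric_nabla_xi //;
  rewrite !p1 !p2 !(metricNl, metricNr) g11 g22 g12 g13 g23 g21 g31 g32; ring.
Qed.

End NewmanPenroseFrame.

(** * Covariant derivatives of the frame fields *)

Section NewmanPenroseEquations.
Variables (R : realType) (M : smoothManifold R 3) (S : almostContactMetric M).
Variables (nabla : vfield M -> vfield M -> vfield M) (alpha beta : smoothFun M).
Variables (e1 e2 : vfield M).
Hypothesis LC : levi_civita (acm_metric S) nabla.
Hypothesis tsS : trans_sasakian S nabla alpha beta.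
Hypothesis npe : np_frame S e1 e2.
Local Notation G := (cext2 (metric (acm_metric S))).
Local Notation N := (cext2 nabla).
Local Notation D := (cext2 (@vder R 3 M)).
Local Notation d := (np_vector e1 e2).
Local Notation db := (cconj (np_vector e1 e2)).
Local Notation x := (cembed (xi S)).
Local Notation r := (rho_np S nabla e1 e2).
Local Notation b := (beta_np S nabla e1 e2).
Local Notation ep := (epsilon_np S nabla e1 e2).

Lemma cder0 (X : cplx (vfield M)) : D X (0 : cplx (smoothFun M)) = 0.
Proof. by apply: cplx_eq; rewrite /= !vder0r ?subr0 ?addr0. Qed.

Lemma cder1 (X : cplx (vfield M)) : D X (1, 0) = 0.
Proof. by apply: cplx_eq; rewrite /= !vder0r !vder1r ?subr0 ?addr0. Qed.

Lemma cvalue1 (p : M) : cvalue (1, 0) p = 1 :> R[i].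
Proof. by []. Qed.

(** Applied to g(V, nabla_X V) with g(V, V) constant, which metric compatibility makes equal to its
    own opposite. *)
Lemma cplx_double_eq0 (f : cplx (smoothFun M)) : f = - f -> f = 0.
Proof.
move=> E; apply: cvalue_eq => p; have := congr1 (fun h => cvalue h p) E.
rewrite cvalueN => /eqP; rewrite -addr_eq0 -mulr2n mulrn_eq0 /= => /eqP ->.
by rewrite cvalue0.
Qed.

Lemma cconj_xi : cconj x = x.
Proof. by apply: cplx_eq => //=; rewrite oppr0. Qed.

Let c0 (V : cplx (vfield M)) : cplx_scale 0 V = 0.
Proof. by apply: cplx_eq; rewrite /= !scale0r ?subr0 ?addr0. Qed.

(** The [db]-coefficient is sigma up to sign, the xi-coefficient vanishes by unit length, and the
    [d]-coefficient is the conjugate of the product defining [rho_np]. *)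
Lemma cnabla_d_xi : N d x = cplx_scale (cconj r) d.
Proof.
have [Gdd Gbb Gdb Gbd [Gxx Gdx Gxd Gbx Gxb]] := np_metric npe.
rewrite [LHS](np_decomp npe) (sigma_np_eq0 npe LC tsS) c0 addr0.
have -> : G x (N d x) = 0.
  by apply: cplx_double_eq0; rewrite -(cnabla_skew LC) 1?cmetricC // Gxx cder1.
rewrite c0 addr0; congr cplx_scale.
rewrite /rho_np /cmetric -cmetric_conj /cnabla -(cnabla_conj LC) !cconjK.
by rewrite cconj_xi.
Qed.

Lemma cnabla_db_xi : N db x = cplx_scale r db.
Proof.
rewrite -[r]cconjK -cplx_scale_conj -cnabla_d_xi -(cnabla_conj LC).
by rewrite cconj_xi.
Qed.

(** [d] is null, which removes [db]; skewness turns the xi-coefficient into sigma = 0. *)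
Lemma cnabla_d_d : N d d = cplx_scale b d.
Proof.
have [Gdd Gbb Gdb Gbd [Gxx Gdx Gxd Gbx Gxb]] := np_metric npe.
rewrite [LHS](np_decomp npe).
have -> : G d (N d d) = 0.
  by apply: cplx_double_eq0; rewrite -(cnabla_skew LC) 1?cmetricC // Gdd cder0.
have -> : G x (N d d) = 0.
  apply: oppr_inj; rewrite -(cnabla_skew LC) ?Gxd ?cder0 // cmetricC oppr0.
  exact: (sigma_np_eq0 npe LC tsS).
by rewrite !c0 !addr0.
Qed.

Lemma cnabla_db_db : N db db = cplx_scale (cconj b) db.
Proof. by rewrite (cnabla_conj LC) cnabla_d_d cplx_scale_conj. Qed.

(** By skewness the xi-coefficient is minus the product defining [rho_np], and the [d]-coefficient
    is minus g(d, nabla_db db), the conjugate of [beta_np]. *)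
Lemma cnabla_db_d : N db d = - cplx_scale (cconj b) d - cplx_scale r x.
Proof.
have [Gdd Gbb Gdb Gbd [Gxx Gdx Gxd Gbx Gxb]] := np_metric npe.
rewrite [LHS](np_decomp npe).
have -> : G d (N db d) = 0.
  by apply: cplx_double_eq0; rewrite -(cnabla_skew LC) 1?cmetricC // Gdd cder0.
have -> : G x (N db d) = - r.
  by rewrite -[LHS]opprK -(cnabla_skew LC) ?Gxd ?cder0 // cmetricC.
have -> : G db (N db d) = - cconj b.
  rewrite -[LHS]opprK -(cnabla_skew LC) ?Gbd ?cder1 // cmetricC.
  by rewrite (cnabla_conj LC) -[d in G d _]cconjK cmetric_conj.
by rewrite c0 addr0 !cplx_scaleNl.
Qed.

Lemma cnabla_d_db : N d db = - cplx_scale b db - cplx_scale (cconj r) x.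
Proof.
rewrite -[N d db]cconjK -(cnabla_conj LC) cconjK cnabla_db_d.
by rewrite cconjD !cconjN !cplx_scale_conj cconjK cconj_xi.
Qed.

(** The xi-coefficient is minus g(nabla_xi xi, d), which is zero. *)
Lemma cnabla_xi_d : N x d = cplx_scale ep d.
Proof.
have [Gdd Gbb Gdb Gbd [Gxx Gdx Gxd Gbx Gxb]] := np_metric npe.
rewrite [LHS](np_decomp npe).
have -> : G d (N x d) = 0.
  by apply: cplx_double_eq0; rewrite -(cnabla_skew LC) 1?cmetricC // Gdd cder0.
have -> : G x (N x d) = 0.
  apply: oppr_inj; rewrite -(cnabla_skew LC) ?Gxd ?cder0 //.
  by rewrite (cnabla_xi_xi npe LC tsS) cmetric0l oppr0.
by rewrite !c0 !addr0.
Qed.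

(** Differentiating g(db, d) = 1 along xi gives two terms, conjugate to each other, with sum
    zero. *)
Lemma epsilon_np_conj : cconj ep = - ep.
Proof.
have [Gdd Gbb Gdb Gbd _] := np_metric npe.
rewrite {2}/epsilon_np /cmetric /cnabla -(cnabla_skew LC) ?Gbd ?cder1 //.
have -> : N x db = cconj (N x d) by rewrite -{1}cconj_xi (cnabla_conj LC).
transitivity (G (cconj (N x d)) (cconj db)); first by rewrite cmetric_conj cmetricC.
by rewrite cconjK.
Qed.

Lemma cnabla_xi_db : N x db = - cplx_scale ep db.
Proof.
by rewrite -cplx_scaleNl -epsilon_np_conj -cplx_scale_conj -cnabla_xi_d
  -(cnabla_conj LC) cconj_xi.
Qed.

(** * Curvature components in the frame *)

Definition np_nablaE := (cnabla_d_xi, cnabla_db_xi, cnabla_d_d, cnabla_db_db,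
  cnabla_db_d, cnabla_d_db, cnabla_xi_d, cnabla_xi_db, cnabla_xi_xi npe LC tsS).

Definition cnablaE := (cnablaDl LC, cnablaDr LC, cnablaNl LC, cnablaNr LC,
  cnablaZl LC, cnablaZr LC, cnabla0r LC).

(* [m] is the contraction with [W] at [p], made opaque: rewriting under the
   unfolded metric is prohibitively slow. *)
Lemma cmetric_at_functional (W : cplx (vfield M)) (p : M) :
  exists m : cplx (vfield M) -> R[i],
  [/\ forall V, cvalue (G V W) p = m V, forall U V, m (U + V) = m U + m V,
    forall V, m (- V) = - m V, m 0 = 0 &
    forall f V, m (cplx_scale f V) = cvalue f p * m V].
Proof.
exists (fun V => cvalue (G V W) p); split=> // [U V|V||f V].
- by rewrite cmetricDl.
- by rewrite cmetricNl.
- by rewrite cmetric0l.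
- exact: cvalue_metric_scale.
Qed.

(** The bracket [d, db] has xi-part rho - conj(rho), the source of the epsilon term; its [d]- and
    [db]-parts give 2|beta|^2. The term |rho|^2 comes from the xi-part of nabla_d db. *)
Lemma curvature_d_db_db_d (p : M) :
  cvalue (curvature4 S nabla d db db d) p =
    cvalue r p * (cvalue r p)^* + 2 * (cvalue b p * (cvalue b p)^*)
    + (cvalue r p - (cvalue r p)^*) * cvalue ep p
    + cvalue (D d (cconj b)) p + cvalue (D db b) p.
Proof.
have [Gdd Gbb Gdb Gbd [Gxx Gdx Gxd Gbx Gxb]] := np_metric npe.
have [m [mE mD mN m0 mZ]] := cmetric_at_functional d p.
rewrite /curvature4 /cmetric mE /curvature /cbracket /cnabla.
(* The table is used twice: expanding its first output exposes new derivatives of frame fields. *)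
rewrite (cbracketE LC) !np_nablaE !cnablaE !np_nablaE !(mD, mN, m0, mZ).
rewrite -!mE ?Gdd Gbd Gxd !cvalue_conj !cvalue0 !cvalue1.
ring.
Qed.

(** Only the [db]-part survives the product with [d], and in it the terms beta rho cancel. *)
Lemma curvature_d_db_xi_d (p : M) :
  cvalue (curvature4 S nabla d db x d) p = cvalue (D d r) p.
Proof.
have [Gdd Gbb Gdb Gbd [Gxx Gdx Gxd Gbx Gxb]] := np_metric npe.
have [m [mE mD mN m0 mZ]] := cmetric_at_functional d p.
rewrite /curvature4 /cmetric mE /curvature /cbracket /cnabla.
rewrite (cbracketE LC) !np_nablaE !cnablaE !np_nablaE !(mD, mN, m0, mZ).
rewrite -!mE ?Gdd Gbd Gxd !cvalue_conj !cvalue0 !cvalue1.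
ring.
Qed.

(** R(d, xi)xi is a multiple of [d], the epsilon terms cancelling; a general [W] serves both
    remaining components. *)
Lemma curvature_d_xi_xi (W : cplx (vfield M)) (p : M) :
  cvalue (curvature4 S nabla d x x W) p =
  - (cvalue (D x (cconj r)) p + (cvalue r p)^* ^+ 2) * cvalue (G d W) p.
Proof.
have [m [mE mD mN m0 mZ]] := cmetric_at_functional W p.
rewrite /curvature4 /cmetric mE /curvature /cbracket /cnabla.
rewrite (cbracketE LC) !np_nablaE !cnablaE !np_nablaE !(mD, mN, m0, mZ).
rewrite mE !cvalue_conj.
ring.
Qed.

(** In the Bianchi sum, R(d, db)xi has no xi-component, R(db, xi)d contributes xi(rho) + rho^2, and
    R(xi, d)db contributes minus its conjugate. *)
Lemma xi_rho_real (p : M) :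
  cvalue (D x (cconj r)) p + (cvalue r p)^* ^+ 2 =
  cvalue (D x r) p + cvalue r p ^+ 2.
Proof.
have [Gdd Gbb Gdb Gbd [Gxx Gdx Gxd Gbx Gxb]] := np_metric npe.
have [m [mE mD mN m0 mZ]] := cmetric_at_functional x p.
have := congr1 m (cbianchi LC d db x); rewrite /=.
rewrite !(cbracketE LC) !np_nablaE !cnablaE !np_nablaE !(mD, mN, m0, mZ).
rewrite -!mE Gdx Gbx Gxx !cvalue_conj !cvalue0 !cvalue1.
move=> bianchi_xi; apply/eqP; rewrite -subr_eq0 -oppr_eq0 -[0]bianchi_xi.
by apply/eqP; ring.
Qed.

End NewmanPenroseEquations.

(** * The four curvature formulas at a point *)

Theorem proposition4p17 (R : realType) (M : smoothManifold R 3)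
    (S : almostContactMetric M) (nabla : vfield M -> vfield M -> vfield M)
    (alpha beta : smoothFun M) (e1 e2 : vfield M)
    (nablaLC : levi_civita (acm_metric S) nabla)
    (tsS : trans_sasakian S nabla alpha beta)
    (npe : np_frame S e1 e2) :
  let d := np_vector e1 e2 in
  let db := cconj d in
  let x := cembed (xi S) in
  let Rm := curvature4 S nabla in
  let rho := rho_np S nabla e1 e2 in
  let beta_ := beta_np S nabla e1 e2 in
  let eps := epsilon_np S nabla e1 e2 in
  forall p : M,
  [/\ cvalue (Rm d db db d) p =
        `|cvalue rho p| ^+ 2 + 2 * `|cvalue beta_ p| ^+ 2
        + (cvalue rho p - (cvalue rho p)^*) * cvalue eps p
        + cvalue (cder d (cconj beta_)) p + cvalue (cder db beta_) p,
      cvalue (Rm d db x d) p = cvalue (cder d rho) p,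
      cvalue (Rm d x x d) p = 0 &
      cvalue (Rm d x x db) p = - cvalue (cder x rho) p - cvalue rho p ^+ 2].
Proof.
move=> d db x Rm rho beta_ eps p.
have [Gdd _ Gdb _ _] := np_metric npe.
split.
- by rewrite !normCK; exact: (curvature_d_db_db_d nablaLC tsS npe).
- exact: (curvature_d_db_xi_d nablaLC tsS npe).
- by rewrite (curvature_d_xi_xi nablaLC tsS npe) Gdd cvalue0 mulr0.
(* The computation yields the formula in conj(rho); reality of xi(rho) + rho^2 removes the
   conjugation. *)
- rewrite (curvature_d_xi_xi nablaLC tsS npe) Gdb (xi_rho_real nablaLC tsS npe).
  by rewrite mulr1 opprD.
Qed.
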